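(* Let $q=p^k>4$, with $p$ an odd prime, and let $n\ge1$. (i) If $A\subseteq(\mathbb{F}_q^\times)^n$ is strongly $e_{p-1}$-free of length $p$ relative to the torus, then $$|A|\le p\,M_{q-1}\left(n,\left\lfloor\frac{(q-1)n}{p}\right\rfloor\right)\le p\,\eta_{q,p}^n,\qquad\eta_{q,p}<q-1.$$ (ii) If $A\subseteq(\mathbb{F}_q^\times)^n$ is distinctly $e_{p-1}$-free of length $p$ relative to the torus, then $$|A|\le B_p\,\vartheta_q^n,\qquad\vartheta_q<q-1.$$ If $S$ is a sequence over $(\mathbb{F}_q^\times)^n$ with no length-$p$ subsequence on which $e_{p-1}$ vanishes coordinatewise, then $$|S|\le(p-1)B_p\,\vartheta_q^n.$$
   Context: $\mathbb{F}_q^\times=\mathbb{F}_q\setminus\{0\}$. $e_{p-1}(x_1,\dots,x_p)=\sum_{1\le i_1<\cdots<i_{p-1}\le p}x_{i_1}\cdots x_{i_{p-1}}$, applied coordinatewise to vectors. A set $A\subseteq(\mathbb{F}_q^\times)^n$ is strongly $e_{p-1}$-free of length $p$ relative to the torus if every $p$-tuple of (not necessarily distinct) elements of $A$ on which $e_{p-1}$ vanishes coordinatewise is constant; it is distinctly $e_{p-1}$-free of length $p$ relative to the torus if no $p$ pairwise distinct elements of $A$ annihilate $e_{p-1}$ coordinatewise. A sequence may have repeated values, $|S|$ is its length, and a length-$p$ subsequence consists of $p$ terms with distinct indices. For integers $Q\ge2$, $D\ge0$, $M_Q(n,D)=|\{(a_1,\dots,a_n)\in\{0,\dots,Q-1\}^n:a_1+\cdots+a_n\le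 D\}|$. $B_p=\sum_{r=3}^pr\,S(p,r)$ with $S(p,r)$ the Stirling number of the second kind, and $$\vartheta_q=\inf_{0<\rho<1}(1+\rho+\cdots+\rho^{q-2})\rho^{-(q-1)/3},\qquad\eta_{q,p}=\inf_{0<\rho<1}(1+\rho+\cdots+\rho^{q-2})\rho^{-(q-1)/p}.$$ *)

(* Defs.v *)
From HB Require Import structures.
From mathcomp Require Import all_boot all_order all_algebra.
From mathcomp Require Import boolp classical_sets reals exp.

Set Implicit Arguments.
Unset Strict Implicit.
Unset Printing Implicit Defensive.

Import Order.TTheory GRing.Theory Num.Theory.
Local Open Scope ring_scope.

Definition esym (F : fieldType) (m d : nat) (x : 'I_m -> F) : F :=
  \sum_(I : {set 'I_m} | #|I| == d) \prod_(i in I) x i.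

Definition torus (F : finFieldType) (n : nat) : {set 'rV[F]_n} :=
  [set v : 'rV[F]_n | [forall j, v 0 j != 0]].

Definition esym_vanishes (F : fieldType) (n p : nat)
    (x : 'I_p -> 'rV[F]_n) : Prop :=
  forall j : 'I_n, esym p.-1 (fun i => x i 0 j) = 0.

Definition strongly_free (F : finFieldType) (n p : nat)
    (A : {set 'rV[F]_n}) : Prop :=
  forall x : 'I_p -> 'rV[F]_n,
    (forall i, x i \in A) -> esym_vanishes x -> forall i j, x i = x j.

Definition distinctly_free (F : finFieldType) (n p : nat)
    (A : {set 'rV[F]_n}) : Prop :=
  forall x : 'I_p -> 'rV[F]_n,
    (forall i, x i \in A) -> injective x -> ~ esym_vanishes x.

(* [subseq] selects positions, so repeated values of [S] may be used up to
   their multiplicity in [S]. *)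
Definition seq_free (F : finFieldType) (n p : nat)
    (S : seq 'rV[F]_n) : Prop :=
  forall t : p.-tuple 'rV[F]_n, subseq t S -> ~ esym_vanishes (tnth t).

Definition M (Q n D : nat) : nat :=
  #|[set a : {ffun 'I_n -> 'I_Q} | (\sum_(i < n) a i <= D)%N]|.

Definition stirling2 (m r : nat) : nat :=
  #|[set P : {set {set 'I_m}} | finset.partition P [set: 'I_m] & #|P| == r]|.

Definition B (p : nat) : nat := (\sum_(3 <= r < p.+1) r * stirling2 p r)%N.

Definition eta_qp (R : realType) (q p : nat) : R :=
  inf [set y : R | exists2 rho : R, 0 < rho < 1 &
    y = (\sum_(i < q.-1) rho ^+ i) * rho `^ (- (q.-1%:R / p%:R))]%classic.

Definition theta_q (R : realType) (q : nat) : R :=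
  inf [set y : R | exists2 rho : R, 0 < rho < 1 &
    y = (\sum_(i < q.-1) rho ^+ i) * rho `^ (- (q.-1%:R / 3))]%classic.

(* Main.v *)
Require Import Defs.
From HB Require Import structures.
From mathcomp Require Import all_boot all_order all_algebra all_fingroup.
From mathcomp Require Import cyclic pgroup sylow finfield.
From mathcomp Require Import ring lra.
From mathcomp Require Import boolp classical_sets reals exp.
From mathcomp Require Import fintype finset.

Set Implicit Arguments.
Unset Strict Implicit.
Unset Printing Implicit Defensive.

Import Order.TTheory GRing.Theory Num.Theory.
Local Open Scope ring_scope.

(** On the torus, [e_(p-1)] is the product of its arguments times the sum of
their inverses, so after inverting all coordinates the theorem concerns
[p]-tuples of vectors that sum to zero.  With [Q = q - 1], Fermat's little
theorem turns this condition into a polynomial of degree [Q * n]: the tensor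
[prod_j (1 - (sum_i u (y i) j) ^ Q)] is the indicator of zero-sum tuples.

Two facts are then played against each other.  A tensor on [X ^ p] that is a
nonzero constant on the diagonal and zero elsewhere is not a sum of fewer than
[#|X|] products [f * g] in which [f] depends on the variables in a proper
nonempty set of positions and [g] on the others (diagonal_partition_rank).  On
the other hand, let a set partition [pi] of the positions have [r] blocks.  On
tuples that are constant on these blocks every monomial of the zero-sum tensor
is a product of [r] monomials, one per block, and one of them has degree at most
[Q * n / r]; since [x ^ Q = 1] on the torus its exponents may be reduced below
[Q], so that [r * M Q n (Q * n / r)] products suffice (const_on_blocks_slices).

If [A] is strongly free, the zero-sum tensor itself is the diagonal tensor, and
the partition into singletons gives the bound.

If [A] is distinctly free, the zero-sum tensor vanishes on injective tuples.
The indicator of injectivity is the signed sum, over all permutations [s] of the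
positions, of the indicators of [y \o s = y] (sum_sign_fixing), and [y \o s = y]
means that [y] is constant on the cycles of [s].  The permutations with one or
two cycles contribute only diagonal tensors: a zero-sum tuple with two values
[a] and [b] has [m a = m b] for some [0 < m < p].  Their total sign is [-1] in
characteristic [p] (sum_sign_porbits_le2), since conjugation by a [p]-cycle
preserves the number of cycles and fixes only the powers of that [p]-cycle.
Hence the diagonal tensor is a combination of the terms with at least three
cycles, and counting set partitions with [r >= 3] blocks produces [B p].

The real bounds on [M] are Markov's inequality for the weights
[rho ^ (a_1 + ... + a_n)].  The infimum is less than [Q] because the logarithmic
derivative of [(1 + ... + rho ^ (Q - 1)) * rho ^ (- Q / 3)] at [rho = 1] is
[(Q - 1) / 2 - Q / 3], which is positive for [Q > 3].

A sequence as in the last bound contains each value at most [p - 1] times,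
because [p] copies of a vector sum to zero, and its set of values is distinctly
free. *)

(** * Partition rank of diagonal tensors *)

(** The functions supported on [C] and orthogonal to the family form a space of
dimension at least [#|C| - #|P|], and a space of functions of dimension [d]
contains one that is nonzero at [d] points: prescribe the value 1 at the
positions of an invertible minor of a basis. *)
Lemma exists_orthogonal_large_support (K : fieldType) (X S : finType)
    (P : {set S}) (C : {set X}) (f : S -> X -> K) :
  exists h : X -> K,
    [/\ forall x, x \notin C -> h x = 0,
        forall s, s \in P -> \sum_x h x * f s x = 0
      & (#|C| <= #|P| + #|[set x | h x != 0%R]|)%N].
Proof.
pose N : 'M[K]_(#|C|, #|P|) :=
  \matrix_(i, j) f (enum_val j) (enum_val i).
pose Kt := (kermx N)^T.
have [Gr GGr] : exists Gr, rowsub (maxrankfun Kt) Kt *m Gr = 1%:M.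
  by apply/row_freeP/maxrowsub_free.
(* [w] is the element of the kernel whose entries at the pivots are all 1. *)
pose v := Gr *m const_mx 1 : 'cV_#|C|.
pose w := (Kt *m v)^T.
have wN : w *m N = 0 by rewrite /w trmx_mul trmxK -mulmxA mulmx_ker mulmx0.
have w1 k : w 0 (maxrankfun Kt k) = 1.
  have := congr1 (fun A : 'cV_ _ => A k 0) (mul_rowsub_mx (maxrankfun Kt) Kt v).
  by rewrite mulmxA GGr mul1mx mxE [RHS]mxE /w [X in _ -> X = _]mxE => <-.
pose h x := \sum_(i | enum_val i == x) w 0 i.
have hE i : h (enum_val i) = w 0 i.
  rewrite /h (big_pred1 i) // => j /=.
  by rewrite (inj_eq enum_val_inj).
have h0 x : x \notin C -> h x = 0.
  move=> xC; rewrite /h big1 // => i /eqP xi.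
  by rewrite -xi enum_valP in xC.
exists h; split => // [s sP|].
- rewrite (bigID (mem C)) /= [X in _ + X]big1 ?addr0; last first.
    by move=> x /h0 ->; rewrite mul0r.
  rewrite big_enum_val /=.
  have := congr1 (fun A : 'rV_ _ => A 0 (enum_rank_in sP s)) wN.
  rewrite !mxE => e; rewrite -[RHS]e; apply: eq_bigr => i _.
  by rewrite hE [N _ _]mxE enum_rankK_in.
- rewrite -leq_subLR.
  apply: leq_trans (_ : \rank Kt <= _)%N.
    by rewrite mxrank_tr mxrank_ker leq_sub2l // rank_leq_col.
  rewrite -[X in (X <= _)%N]card_ord.
  pose e k := enum_val (maxrankfun Kt k).
  have einj : injective e.
    by move=> k l /enum_val_inj /maxrankfun_inj.
  rewrite -(card_imset _ einj); apply: subset_leq_card.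
  apply/subsetP => x /imsetP[k _ ->].
  by rewrite inE hE w1 oner_eq0.
Qed.

Definition upd (I X : finType) (y : {ffun I -> X}) (v : I) (x : X) :
  {ffun I -> X} := [ffun i => if i == v then x else y i].

Lemma updE (I X : finType) (y : {ffun I -> X}) v x i :
  upd y v x i = if i == v then x else y i.
Proof. by rewrite ffunE. Qed.

(** The variables in [V] are eliminated one at a time, while [v0] is kept to
carry the diagonal.  To eliminate [v], sum over it against a function [h] that is
orthogonal to all the factors depending on [v] alone: these terms disappear,
every other term keeps its form, and the diagonal [c] becomes [h * c], which
loses at most as many points of its support as there are terms removed. *)
Lemma diagonal_rank_rooted (K : fieldType) (X S I : finType) (v0 : I)
    (V : {set I}) (P : {set S}) (c : X -> K) (b : S -> {set I})
    (f g : S -> {ffun I -> X} -> K) :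
  v0 \notin V ->
  (forall s, s \in P -> [/\ b s \subset V, b s != set0,
     forall y z : {ffun I -> X}, {in b s, y =1 z} -> f s y = f s z &
     forall y z : {ffun I -> X}, {in ~: b s, y =1 z} -> g s y = g s z]) ->
  (forall y : {ffun I -> X}, [forall i in V, y i == y v0]%:R * c (y v0)
     = \sum_(s in P) f s y * g s y) ->
  (#|[set x | c x != 0%R]| <= #|P|)%N.
Proof.
move: {2}#|V| (erefl #|V|) => m.
elim: m V P c b f g => [|m IH] V P c b f g Vm v0V sP eqT.
  move/eqP: Vm; rewrite cards_eq0 => /eqP V0.
  have P0 s : s \in P = false.
    apply/negP => /sP [+ + _ _]; rewrite V0 subset0 => /eqP ->.
    by rewrite eqxx.
  rewrite [X in (X <= _)%N]eq_card0 // => x; rewrite !inE.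
  have := eqT [ffun=> x]; rewrite ffunE big_pred0 // => /eqP.
  rewrite mulf_eq0 => /orP[|->//]; rewrite (_ : [forall i in _, _]) ?oner_eq0 //.
  by apply/forall_inP => i; rewrite V0 inE.
have [v vV] : exists v, v \in V by apply/set0Pn; rewrite -cards_eq0 Vm.
have vv0 : v != v0 by apply: contraNneq v0V => <-.
have v0v : (v0 == v) = false by rewrite eq_sym (negPf vv0).
pose P1 := [set s in P | b s == [set v]].
have [h [hC horth hsupp]] := exists_orthogonal_large_support P1
  [set x | c x != 0] (fun s x => f s [ffun=> x]).
have cardP : #|P| = (#|P1| + #|P :\: P1|)%N.
  by rewrite -(cardsID P1 P) (setIidPr _) //; apply/subsetP => s; rewrite inE => /andP[].
apply: leq_trans hsupp _; rewrite cardP leq_add2l.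
pose F s y := \sum_x h x * f s (upd y v x).
pose G s y := \sum_x h x * g s (upd y v x).
have -> : [set x | h x != 0] = [set x | h x * c x != 0].
  apply/setP => x; rewrite !inE mulf_eq0 negb_or.
  case: (boolP (h x == 0)) => //= hx; apply/esym.
  by apply: contraNT hx => cx; rewrite hC ?inE ?cx.
apply: (IH (V :\ v) (P :\: P1) (fun x => h x * c x) (fun s => b s :\ v)
  (fun s => if v \in b s then F s else f s)
  (fun s => if v \in b s then g s else G s)).
- by move: Vm; rewrite (cardsD1 v V) vV => -[].
- by rewrite inE (negPf v0V) andbF.
- move=> s; rewrite !inE => /andP[sP1 sinP].
  have [bV b0 fs gs] := sP s sinP; rewrite sinP /= in sP1; split.
  + by apply: setSD.
  + apply: contraNneq sP1 => bv0.
    rewrite eqEsubset -setD_eq0 bv0 eqxx sub1set /=.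
    case/set0Pn: b0 => i ib; case: (eqVneq i v) => [<-//|iv].
    by have := in_set0 i; rewrite -bv0 !inE iv ib.
  + move=> y z yz; case: ifP => vb.
      apply: eq_bigr => x _; congr (_ * _); apply: fs => i ib.
      by rewrite !updE; case: eqP => // /eqP iv; rewrite yz // !inE iv.
    apply: fs => i ib; rewrite yz // !inE ib andbT.
    by apply: contraFneq vb => <-.
  + move=> y z yz; case: ifP => vb.
      by apply: gs => i ib; rewrite yz // !inE negb_and; rewrite inE in ib; rewrite ib orbT.
    apply: eq_bigr => x _; congr (_ * _); apply: gs => i ib.
    rewrite !updE; case: eqP => // /eqP iv; rewrite yz // !inE negb_and.
    by rewrite inE in ib; rewrite ib orbT.
- move=> y.
  transitivity (\sum_x h x * \sum_(s in P) f s (upd y v x) * g s (upd y v x)).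
    have yv0 x : upd y v x v0 = y v0 by rewrite updE v0v.
    under eq_bigr => x _ do rewrite -eqT yv0.
    rewrite (bigD1 (y v0)) //= [X in _ + X]big1 ?addr0 => [|x xy]; last first.
      rewrite (_ : [forall i in _, _] = false) ?mul0r ?mulr0 //.
      apply/negP => /forall_inP/(_ v vV); rewrite updE eqxx.
      by apply/negP.
    rewrite mulrCA; congr (_ * (_ %:R * _)); congr nat_of_bool.
    apply/forall_inP/forall_inP => [yV i iV|yV i].
      by rewrite updE; case: (eqVneq i v) => [_|iv]; rewrite ?eqxx // yV // !inE iv.
    by rewrite !inE => /andP[iv iV]; have := yV i iV; rewrite updE (negPf iv).
  under eq_bigr => x _ do rewrite mulr_sumr.
  rewrite exchange_big /=.
  rewrite (bigID (mem P1)) /= [X in X + _]big1 ?add0r => [|s /andP[sinP sP1]].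
    apply: eq_big => [s|s /andP[sinP sP1]]; first by rewrite !inE andbC.
    have [bV b0 fs gs] := sP s sinP; case: ifP => vb.
      rewrite /F mulr_suml; apply: eq_bigr => x _; rewrite mulrA; congr (_ * _).
      apply: gs => i; rewrite inE => ib; rewrite !updE; case: eqP => // iv.
      by rewrite iv vb in ib.
    rewrite /G mulr_sumr; apply: eq_bigr => x _; rewrite mulrCA; congr (_ * _).
    apply: fs => i ib; rewrite !updE; case: eqP => // iv.
    by rewrite -iv ib in vb.
  have [bV b0 fs gs] := sP s sinP.
  have bv : b s = [set v] by apply/eqP; move: sP1; rewrite inE sinP.
  rewrite (eq_bigr (fun x => h x * f s [ffun=> x] * g s y)) => [|x _].
    by rewrite -mulr_suml horth // mul0r.
  rewrite mulrA; congr (_ * _ * _); [apply: fs|apply: gs] => i; rewrite bv !inE.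
    by move=> /eqP ->; rewrite updE ffunE eqxx.
  by rewrite !updE => /negPf ->.
Qed.

(** The two factors of a term play symmetric roles, so the set of positions of
the first one may be taken to avoid [v0]. *)
Lemma diagonal_partition_rank (K : fieldType) (X S I : finType) (v0 : I)
    (P : {set S}) (c : X -> K) (b : S -> {set I})
    (f g : S -> {ffun I -> X} -> K) :
  (forall s, s \in P -> [/\ b s != set0, b s != [set: I],
     forall y z : {ffun I -> X}, {in b s, y =1 z} -> f s y = f s z &
     forall y z : {ffun I -> X}, {in ~: b s, y =1 z} -> g s y = g s z]) ->
  (forall y : {ffun I -> X}, [forall i, y i == y v0]%:R * c (y v0)
     = \sum_(s in P) f s y * g s y) ->
  (#|[set x | c x != 0%R]| <= #|P|)%N.
Proof.
move=> sP eqT.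
pose b' s := if v0 \in b s then ~: b s else b s.
pose f' s := if v0 \in b s then g s else f s.
pose g' s := if v0 \in b s then f s else g s.
apply: (@diagonal_rank_rooted _ _ _ _ v0 (~: [set v0]) P c b' f' g').
- by rewrite !inE eqxx.
- move=> s /sP[b0 bT fs gs]; rewrite /b' /f' /g'; case: ifP => vb; split => //.
  + by rewrite setCS sub1set.
  + by apply: contraNneq bT => /(congr1 (@setC _)); rewrite setCK setC0 => ->.
  + by rewrite setCK.
  + by rewrite subsetC sub1set inE vb.
- move=> y; rewrite (_ : [forall i in _, _] = [forall i, y i == y v0]).
    rewrite eqT; apply: eq_bigr => s _; rewrite /f' /g'.
    by case: ifP => // _; rewrite mulrC.
  apply: eq_forallb => i; rewrite !inE.
  by case: (eqVneq i v0) => [->|//]; rewrite eqxx.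
Qed.

(** * Slicing the zero-sum tensor along a set partition *)

Definition all_eq_on (I X : finType) (b : {set I}) (y : {ffun I -> X}) : bool :=
  [forall i in b, forall k in b, y i == y k].

Definition zero_sum_tensor (F : fieldType) (I X : finType) (n Q : nat)
    (u : X -> 'I_n -> F) (y : {ffun I -> X}) : F :=
  \prod_j (1 - (\sum_i u (y i) j) ^+ Q).

Definition const_on_blocks (I X : finType) (pi : {set {set I}})
    (y : {ffun I -> X}) : bool :=
  [forall b in pi, all_eq_on b y].

Section Expansion.
Variables (F : fieldType) (I X : finType) (n Q : nat) (u : X -> 'I_n -> F).
Hypothesis Q_gt0 : (0 < Q)%N.
Hypothesis uQ : forall x j, u x j ^+ Q = 1.

(* Expanding [1 - (sum_i u (y i) j) ^ Q] for all [j] means to choose, for every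
   [j], either the term 1 or the position used in each of the [Q] factors of the
   power.  No monomials are collected at this stage. *)
Let choices := {ffun 'I_n -> option {ffun 'I_Q -> I}}.

Let coef (E : choices) : F := \prod_j (if E j is Some _ then -1 else 1).

Let deg (E : choices) (b : {set I}) (j : 'I_n) : nat :=
  if E j is Some g then #|[set i | g i \in b]| else 0%N.

Let block_factor (E : choices) (b : {set I}) (y : {ffun I -> X}) : F :=
  \prod_j (if E j is Some g then \prod_(i | g i \in b) u (y (g i)) j else 1).

Lemma zero_sum_tensor_expand (pi : {set {set I}}) (y : {ffun I -> X}) :
  partition pi [set: I] ->
  zero_sum_tensor Q u y =
  \sum_(E : choices) coef E * \prod_(b in pi) block_factor E b y.
Proof.
move=> piP.
pose G (j : 'I_n) (o : option {ffun 'I_Q -> I}) : F :=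
  (if o is Some _ then -1 else 1) *
  (if o is Some g then \prod_i u (y (g i)) j else 1).
transitivity (\prod_j \sum_o G j o).
  apply: eq_bigr => j _; rewrite (bigD1 None) //= /G mulr1; congr (_ + _).
  rewrite (reindex_omap Some id) /=; last by case.
  rewrite [RHS](eq_bigl predT) => [|g]; last by apply/eqP.
  rewrite -[X in _ ^+ X]card_ord -prodr_const bigA_distr_bigA /= -sumrN.
  by apply: eq_bigr => g _; rewrite mulN1r.
rewrite bigA_distr_bigA /=; apply: eq_bigr => E _.
rewrite big_split /=; congr (_ * _).
rewrite exchange_big /=; apply: eq_bigr => j _.
case: (E j) => [g|]; last by rewrite big1.
rewrite (exchange_big_dep predT) //=; apply: eq_bigr => i _.
have /and3P[/eqP cov triv _] := piP.
have gi : g i \in cover pi by rewrite cov inE.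
rewrite (big_pred1 (pblock pi (g i))) // => b /=.
apply/andP/eqP => [[bpi gb]|->]; first by rewrite (def_pblock triv bpi gb).
by rewrite pblock_mem // mem_pblock.
Qed.

(** On a tuple constant on [b] all the variables with positions in [b] coincide,
and the exponents matter only modulo [Q]. *)
Lemma block_factor_monomial (E : choices) (b : {set I}) (i : I)
    (y : {ffun I -> X}) :
  i \in b -> all_eq_on b y ->
  block_factor E b y = \prod_j u (y i) j ^+ (deg E b j %% Q).
Proof.
move=> ib /forall_inP yb; apply: eq_bigr => j _; rewrite /deg.
case: (E j) => [g|]; last by rewrite mod0n expr0.
rewrite (eq_bigr (fun=> u (y i) j)); last first.
  by move=> k gk; have /forall_inP/(_ _ ib)/eqP -> := yb _ gk.
by rewrite prodr_const -cardsE [in LHS](divn_eq #|_| Q) exprD mulnC exprM uQ expr1n mul1r.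
Qed.

Lemma sum_deg_le (E : choices) (pi : {set {set I}}) :
  partition pi [set: I] ->
  (\sum_(b in pi) \sum_j deg E b j <= Q * n)%N.
Proof.
move=> piP; rewrite exchange_big /=.
rewrite mulnC -[X in (_ <= X * _)%N]card_ord -sum_nat_const; apply: leq_sum => j _.
rewrite /deg; case: (E j) => [g|]; last by rewrite big1.
have /and3P[/eqP cov triv _] := piP.
under eq_bigr => b _ do rewrite -sum1dep_card.
rewrite (exchange_big_dep predT) //= -[X in (_ <= X)%N]card_ord -sum1_card.
apply: leq_sum => i _.
have gi : g i \in cover pi by rewrite cov inE.
rewrite (big_pred1 (pblock pi (g i))) // => b /=.
apply/andP/eqP => [[bpi gb]|->]; first by rewrite (def_pblock triv bpi gb).
by rewrite pblock_mem // mem_pblock.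
Qed.

(** The block of least degree is at most the average. *)
Lemma low_degree_block (E : choices) (pi : {set {set I}}) :
  partition pi [set: I] -> (0 < #|pi|)%N ->
  exists2 b, b \in pi & (\sum_j deg E b j <= Q * n %/ #|pi|)%N.
Proof.
move=> piP /card_gt0P[b0 b0pi].
have pi0 : (0 < #|pi|)%N by apply/card_gt0P; exists b0.
case: (arg_minnP (fun b => \sum_j deg E b j)%N b0pi) => b bpi bmin.
exists b => //; rewrite leq_divRL // mulnC -sum_nat_const.
by apply: leq_trans (sum_deg_le E piP); apply: leq_sum.
Qed.

Let term := ({set I} * {ffun 'I_n -> 'I_Q})%type.

Definition low_terms (pi : {set {set I}}) : {set term} :=
  [set t : term | (t.1 \in pi) && (\sum_(j < n) t.2 j <= Q * n %/ #|pi|)%N].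

Lemma card_low_terms (pi : {set {set I}}) :
  #|low_terms pi| = (#|pi| * M Q n (Q * n %/ #|pi|))%N.
Proof.
rewrite /M -cardsX; congr #|pred_of_set _|.
by apply/setP => -[b a]; rewrite !inE.
Qed.

(** Each choice [E] is attached to a block of low degree and to the reduced
exponents of its monomial on that block.  Collecting the choices with the same
block and exponents leaves one product for each pair: [f] is the monomial on the
block, and [g] gathers everything that depends on the other blocks. *)
Lemma const_on_blocks_slices (pi : {set {set I}}) :
  partition pi [set: I] -> (0 < #|pi|)%N ->
  exists f g : term -> {ffun I -> X} -> F,
  [/\ forall t, t \in low_terms pi -> forall y z : {ffun I -> X},
        {in t.1, y =1 z} -> f t y = f t z,
      forall t, t \in low_terms pi -> forall y z : {ffun I -> X},
        {in ~: t.1, y =1 z} -> g t y = g t z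
    & forall y, (const_on_blocks pi y)%:R * zero_sum_tensor Q u y =
        \sum_(t in low_terms pi) f t y * g t y].
Proof.
move=> piP pi0.
pose low E b := (b \in pi) && (\sum_j deg E b j <= Q * n %/ #|pi|)%N.
pose beta E := odflt set0 [pick b | low E b].
have betaP E : low E (beta E).
  rewrite /beta; case: pickP => //= none.
  by have [b bpi bE] := low_degree_block E piP pi0; have := none b; rewrite /low bpi bE.
pose alpha E : {ffun 'I_n -> 'I_Q} :=
  [ffun j => Ordinal (ltn_pmod (deg E (beta E) j) Q_gt0)].
have [/eqP cov triv nov] := and3P piP.
pose f (t : term) y := (all_eq_on t.1 y)%:R *
  (if [pick i in t.1] is Some i then \prod_j u (y i) j ^+ t.2 j else 1).
pose g (t : term) y := \sum_(E | (beta E, alpha E) == t)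
  coef E * \prod_(b in pi | b != t.1) ((all_eq_on b y)%:R * block_factor E b y).
have eq_on (b : {set I}) (y z : {ffun I -> X}) :
    {in b, y =1 z} -> all_eq_on b y = all_eq_on b z.
  move=> yz; apply: eq_forallb_in => i ib; apply: eq_forallb_in => k kb.
  by rewrite !yz.
exists f, g; split => [t _ y z yz|t tP y z yz|y].
- rewrite /f (eq_on _ _ _ yz); case: pickP => // i it.
  by rewrite yz.
- apply: eq_bigr => E _; congr (_ * _); apply: eq_bigr => b /andP[bpi bt].
  have sub : {in b, y =1 z}.
    move=> i ib; apply: yz; rewrite inE.
    have tpi : t.1 \in pi by move: tP; rewrite inE => /andP[].
    by have /trivIsetP/(_ _ _ bpi tpi bt)/pred0P/(_ i)/= := triv; rewrite ib /= => ->.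
  rewrite (eq_on _ _ _ sub); congr (_ * _); apply: eq_bigr => j _.
  by case: (E j) => // h; apply: eq_bigr => i hi; rewrite sub.
- rewrite (zero_sum_tensor_expand _ piP) mulr_sumr.
  rewrite (partition_big (fun E => (beta E, alpha E)) (mem (low_terms pi))) /=; last first.
    move=> E _; have /andP[bpi bE] := betaP E; rewrite inE /= bpi.
    apply: leq_trans bE; apply: leq_sum => j _; rewrite ffunE /=; exact: leq_mod.
  apply: eq_bigr => t tP; rewrite /g mulr_sumr; apply: eq_bigr => E /eqP Et.
  have -> : (const_on_blocks pi y)%:R = \prod_(b in pi) (all_eq_on b y)%:R :> F.
    case: (boolP (const_on_blocks pi y)) => [/forall_inP yP|].
      by rewrite big1 // => b /yP ->.
    rewrite negb_forall_in => /exists_inP[b bpi /negPf yb].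
    by rewrite (bigD1 b) //= yb mul0r.
  have tpi : t.1 \in pi by move: tP; rewrite inE => /andP[].
  rewrite mulrCA -big_split /= (bigD1 t.1) //= mulrCA; congr (_ * _).
  rewrite /f; case: (boolP (all_eq_on t.1 y)) => yt; rewrite ?mul0r // !mul1r.
  case: pickP => [i it|t0].
    rewrite (block_factor_monomial E it yt); apply: eq_bigr => j _.
    by rewrite -Et /= ffunE.
  case/negP: nov; rewrite (_ : set0 = t.1) //.
  by apply/setP => i; rewrite inE t0.
Qed.

End Expansion.

(** If a combination of the restrictions of the zero-sum tensor to partitions
[pi] is diagonal, then the slices of all these restrictions together number at
least [#|X|].  The condition on [#|pi|] makes every block a proper set of
positions. *)
Lemma diagonal_expansion_bound (F : fieldType) (I X : finType) (i0 : I)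
    (n Q : nat) (u : X -> 'I_n -> F) (Pi : {set {set {set I}}})
    (mu : {set {set I}} -> F) (c : F) :
  (0 < Q)%N -> (forall x j, u x j ^+ Q = 1) -> c != 0 ->
  (forall pi, pi \in Pi -> partition pi [set: I] /\ (1 < #|pi|)%N) ->
  (forall y : {ffun I -> X}, [forall i, y i == y i0]%:R * c =
     \sum_(pi in Pi) mu pi * ((const_on_blocks pi y)%:R * zero_sum_tensor Q u y)) ->
  (#|X| <= \sum_(pi in Pi) #|pi| * M Q n (Q * n %/ #|pi|))%N.
Proof.
move=> Q0 uQ c0 PiP eqT.
have ex pi : exists fg : ({set I} * {ffun 'I_n -> 'I_Q} -> {ffun I -> X} -> F) *
    ({set I} * {ffun 'I_n -> 'I_Q} -> {ffun I -> X} -> F), pi \in Pi ->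
  [/\ forall t, t \in low_terms n Q pi -> forall y z : {ffun I -> X},
        {in t.1, y =1 z} -> fg.1 t y = fg.1 t z,
      forall t, t \in low_terms n Q pi -> forall y z : {ffun I -> X},
        {in ~: t.1, y =1 z} -> fg.2 t y = fg.2 t z
    & forall y, (const_on_blocks pi y)%:R * zero_sum_tensor Q u y =
        \sum_(t in low_terms n Q pi) fg.1 t y * fg.2 t y].
  have [piP|] := boolP (pi \in Pi); last by exists (fun _ _ => 0, fun _ _ => 0).
  have [pP p1] := PiP _ piP.
  have [f [g fgP]] := const_on_blocks_slices Q0 uQ pP (ltnW p1).
  by exists (f, g).
have [fg fgP] := choice ex.
pose S : finType := ({set {set I}} * ({set I} * {ffun 'I_n -> 'I_Q}))%type.
pose P : {set S} := [set s : S | (s.1 \in Pi) && (s.2 \in low_terms n Q s.1)].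
have -> : (\sum_(pi in Pi) #|pi| * M Q n (Q * n %/ #|pi|))%N = #|P|.
  rewrite -sum1_card (eq_bigl (fun s : S => (s.1 \in Pi) && (s.2 \in low_terms n Q s.1))).
    rewrite -(pair_big_dep (mem Pi) (fun pi t => t \in low_terms n Q pi) (fun _ _ => 1%N)) /=.
    by apply: eq_bigr => pi _; rewrite sum1_card card_low_terms.
  by move=> s; rewrite inE.
have -> : #|X| = #|[set x : X | c != 0]|.
  by rewrite -cardsT; congr #|pred_of_set _|; apply/setP => x; rewrite !inE c0.
apply: (@diagonal_partition_rank F X S I i0 P (fun=> c) (fun s => s.2.1)
  (fun s y => mu s.1 * (fg s.1).1 s.2 y) (fun s y => (fg s.1).2 s.2 y)).
- move=> [pi t]; rewrite inE /= => /andP[piP tP].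
  have [f1 f2 _] := fgP _ piP; have [pP p1] := PiP _ piP.
  have tpi : t.1 \in pi by move: tP; rewrite inE => /andP[].
  have [/eqP cov triv nov] := and3P pP.
  have t0 : t.1 != set0 by apply: contraNneq nov => <-.
  split => //.
  + apply: contraTneq p1 => tT; rewrite -leqNgt -(cards1 t.1).
    apply/subset_leq_card/subsetP => b bpi; rewrite inE.
    apply: contraNT nov => bt; rewrite (_ : set0 = b) //.
    have /trivIsetP/(_ _ _ bpi tpi bt)/pred0P bt0 := triv.
    by apply/setP => i; have := bt0 i; rewrite /= tT !inE andbT.
  + by move=> y z yz; rewrite (f1 _ tP _ _ yz).
  + exact: f2.
- move=> y; rewrite eqT [RHS](eq_bigl (fun s : S =>
    (s.1 \in Pi) && (s.2 \in low_terms n Q s.1))); last first.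
    by move=> s; rewrite inE.
  rewrite -(pair_big_dep (mem Pi) (fun pi t => t \in low_terms n Q pi)
    (fun pi t => mu pi * (fg pi).1 t y * (fg pi).2 t y)) /=.
  apply: eq_bigr => pi piP; have [_ _ ->] := fgP _ piP.
  by rewrite mulr_sumr; apply: eq_bigr => t _; rewrite mulrA.
Qed.

(** * Signed counting of permutations by cycles *)

Lemma partition_porbits (I : finType) (s : {perm I}) :
  partition (porbits s) [set: I].
Proof.
have -> : porbits s = [set orbit 'P%act <[s]>%g x | x in [set: I]].
  by apply/setP => b; apply/imsetP/imsetP => -[x _ ->]; exists x; rewrite ?inE ?porbitE.
apply: orbit_partition; apply/actsP => a _ x; by rewrite !inE.
Qed.

Lemma const_on_porbits (I X : finType) (s : {perm I}) (y : {ffun I -> X}) :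
  const_on_blocks (porbits s) y = [forall i, y (s i) == y i].
Proof.
apply/forall_inP/forallP => [yP i|ys b /imsetP[i _ ->]].
  have /forall_inP/(_ (s i)) := yP (porbit s i) (imset_f _ isT).
  rewrite (_ : s i \in _) => [/(_ isT)/forall_inP/(_ i)|].
    by rewrite porbit_id => /(_ isT).
  by have := mem_porbit s 1 i; rewrite expg1.
have yi k : k \in porbit s i -> y k = y i.
  case/porbitP => m ->; elim: m => [|m IH]; first by rewrite expg0 perm1.
  by rewrite expgSr permM -IH; apply/eqP.
by apply/forall_inP => k /yi ->; apply/forall_inP => l /yi ->.
Qed.

(** The sum is over the stabilizer of [y], which is trivial if [y] is injective
and otherwise contains a transposition, so that the signs cancel. *)
Lemma sum_sign_fixing (K : pzRingType) (I X : finType) (y : {ffun I -> X}) :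
  \sum_(s : {perm I}) (-1) ^+ s * [forall i, y (s i) == y i]%:R
    = (injectiveb y)%:R :> K.
Proof.
case: (boolP (injectiveb y)) => [/injectiveP yinj|].
  rewrite (bigD1 1%g) //= odd_perm1 expr0 mul1r big1 => [|s s1].
    rewrite (_ : [forall i, _]) ?addr0 //.
    by apply/forallP => i; rewrite perm1.
  rewrite (_ : [forall i, _] = false) ?mulr0 //; apply: contraNF s1 => /forallP ys.
  by apply/eqP/permP => i; rewrite perm1; apply: yinj; apply/eqP.
case/injectivePn => i [k ik yik].
pose t := tperm i k.
have yt l : y (t l) = y l by rewrite /t; case: tpermP => // ->.
have tE s : [forall l, y ((t * s)%g l) == y l] = [forall l, y (s l) == y l].
  apply/forallP/forallP => ys l.
    by have := ys (t l); rewrite permM /t tpermK -/t yt.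
  by rewrite permM -[X in _ == X]yt.
rewrite (bigID (@odd_perm I)) /= [X in _ + X](reindex_inj (mulgI t)) /=.
rewrite [X in _ + X](eq_bigl (@odd_perm I)) => [|s]; last first.
  by rewrite odd_permM odd_tperm ik /= negbK.
rewrite -big_split big1 //= => s sodd.
by rewrite tE odd_permM odd_tperm ik /= sodd expr1 expr0 mulN1r mul1r addNr.
Qed.

Section CyclicShift.
Variable p : nat.
Hypothesis p_prime : prime p.
Hypothesis p_odd : odd p.

Let c : {perm 'I_p} := perm (@ordS_inj p).

Local Open Scope group_scope.

Lemma shiftX (m : nat) (i : 'I_p) : (c ^+ m) i = ((i + m) %% p)%N :> nat.
Proof.
elim: m => [|m IH]; first by rewrite expg0 perm1 addn0 modn_small.
by rewrite expgSr permM permE /= IH -addn1 modnDml -addnA addn1.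
Qed.

Lemma order_shift : #[c] = p.
Proof.
have cp : c ^+ p = 1.
  apply/permP => i; apply/val_inj; rewrite /= shiftX perm1.
  by rewrite modnDr modn_small.
have := order_dvdn c p; rewrite cp eqxx => o.
have /primeP[_ /(_ _ o)/orP[|/eqP//]] := p_prime.
rewrite order_eq1 => /eqP c1.
have := shiftX 1 (Ordinal (prime_gt0 p_prime)).
by rewrite c1 expg1 perm1 /= add0n modn_small // prime_gt1.
Qed.

(** A permutation commuting with the transitive cyclic group [<[c]>] is determined
by the image of one point. *)
Lemma cent_shift : 'C(<[c]>) = <[c]>.
Proof.
apply/eqP; rewrite eqEsubset; apply/andP; split; last by rewrite -abelianE cycle_abelian.
apply/subsetP => s; rewrite cent_cycle => /cent1P sc.
pose o := Ordinal (prime_gt0 p_prime).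
have ctrans (i : 'I_p) : i = (c ^+ i) o.
  by apply/val_inj; rewrite /= shiftX add0n modn_small.
apply/cycleP; exists (s o); apply/permP => i.
have comm m : s * c ^+ m = c ^+ m * s by apply: commuteX; exact: sc.
rewrite {1}(ctrans i) -permM -comm permM {1}(ctrans (s o)) -permM -expgD addnC expgD permM.
by rewrite -ctrans.
Qed.

Lemma porbits_shiftX (s : {perm 'I_p}) :
  s \in <[c]> -> s != 1 -> #|porbits s| = 1%N.
Proof.
move=> sc s1.
have cs : <[s]> = <[c]>.
  apply/eqP; rewrite eqEcard cycle_subG sc /= -!orderE.
  have := order_dvdG sc; rewrite -orderE order_shift => o.
  have /primeP[_ /(_ _ o)/orP[|/eqP->//]] := p_prime.
  by rewrite order_eq1 (negPf s1).
pose o := Ordinal (prime_gt0 p_prime).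
apply/eqP/cards1P; exists [set: 'I_p]; apply/setP => b; rewrite inE.
have orb i : porbit s i = [set: 'I_p].
  apply/setP => k; rewrite inE porbitE cs -porbitE.
  apply/porbitP; exists (k + (p - i))%N; apply/val_inj; rewrite /= shiftX.
  by rewrite addnCA subnKC ?modnDr ?modn_small // ltnW.
by apply/imsetP/eqP => [[i _ ->]|->]; [|exists o].
Qed.

(** Conjugation by the [p]-group [<[c]>] preserves the number of cycles, and its
fixed points are the permutations in ['C(<[c]>) = <[c]>]. *)
Lemma card_porbits_mod (r : nat) :
  #|[set s : {perm 'I_p} | #|porbits s| == r]|
    = #|[set s in <[c]> | #|porbits s| == r]| %[mod p].
Proof.
set S := [set s : {perm _} | _].
have pc : p.-group <[c]> by rewrite /pgroup -orderE order_shift pnat_id.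
have /(pgroup_fix_mod pc) -> : [acts <[c]>, on S | 'J].
  apply/actsP => a _ s; rewrite !inE /=; congr (_ == _).
  have -> : porbits (s ^ a) = [set a @: b | b : {set 'I_p} in porbits s].
    have orbJ i : porbit (s ^ a) (a i) = a @: porbit s i.
      apply/setP => k; apply/porbitP/imsetP => [[m ->]|[l /porbitP[m ->] ->]].
        exists ((s ^+ m) i); first exact: mem_porbit.
        by rewrite -conjXg permJ.
      by exists m; rewrite -conjXg permJ.
    apply/setP => b; apply/imsetP/imsetP => [[i _ ->]|[_ /imsetP[i _ ->] ->]].
      exists (porbit s (a^-1 i)); first by apply: imset_f.
      by rewrite -orbJ permKV.
    by exists (a i) => //; rewrite orbJ.
  rewrite card_imset //; apply: imset_inj; exact: perm_inj.
congr (#|pred_of_set _| %% p)%N; apply/setP => s.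
by rewrite inE afixJ cent_shift !inE andbC.
Qed.

Lemma card_porbits_id : #|porbits (1 : {perm 'I_p})| = p.
Proof.
rewrite -[RHS]card_ord -cardsT.
rewrite -(card_imset [set: 'I_p] set1_inj); congr #|pred_of_set _|.
have orb1 i : porbit (1 : {perm 'I_p}) i = [set i].
  apply/setP => k; rewrite inE.
  by apply/porbitP/eqP => [[m ->]|->]; [rewrite expg1n perm1|exists 0%N; rewrite expg1n perm1].
by apply/setP => b; apply/imsetP/imsetP => -[x _ ->]; exists x; rewrite ?orb1.
Qed.

(** As [p] is odd, the sign is 1 for one cycle and -1 for two.  Among the powers
of [c], the [p - 1] nontrivial ones have one cycle and the identity has [p > 2],
so the two counts are [-1] and [0] modulo [p]. *)
Lemma sum_sign_porbits_le2 (K : nzRingType) : p \in [pchar K] ->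
  (\sum_(s : {perm 'I_p} | (#|porbits s| <= 2)%N) (-1) ^+ s = -1 :> K)%R.
Proof.
move=> pK; have p2 : (2 < p)%N by apply: odd_prime_gt2.
pose N r := #|[set s : {perm 'I_p} | #|porbits s| == r]|.
have N1 : ((N 1%N)%:R = -1 :> K)%R.
  rewrite -(GRing.natr_mod_pchar pK) /N card_porbits_mod (GRing.natr_mod_pchar pK).
  have -> : [set s in <[c]> | #|porbits s| == 1%N] = <[c]> :\ 1.
    apply/setP => s; rewrite !inE andbC; have [sc|] := boolP (s \in <[c]>); last by rewrite !andbF.
    rewrite !andbT; have [->|s1] := eqVneq s 1; last by rewrite porbits_shiftX.
    by rewrite card_porbits_id; apply/negbTE; rewrite neq_ltn prime_gt1 ?orbT.
  have := cardsD1 1 <[c]>; rewrite group1 -orderE order_shift add1n => /(congr1 (fun m => m%:R : K)%R).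
  by rewrite (GRing.pcharf0 pK) -natr1 => /esym/eqP; rewrite addr_eq0 => /eqP.
have N2 : ((N 2)%:R = 0 :> K)%R.
  rewrite -(GRing.natr_mod_pchar pK) /N card_porbits_mod (GRing.natr_mod_pchar pK).
  rewrite (_ : [set s in <[c]> | _] = set0) ?cards0 //.
  apply/setP => s; rewrite !inE; apply/negP => /andP[sc].
  have [->|s1] := eqVneq s 1; last by rewrite porbits_shiftX.
  by rewrite card_porbits_id => /eqP pp; rewrite pp in p2.
have sgnE (s : {perm 'I_p}) : odd_perm s = ~~ odd #|porbits s|.
  by rewrite /odd_perm card_ord p_odd.
rewrite (bigID (fun s => #|porbits s| == 1%N)) /=.
rewrite [RHS](_ : _ = (N 1%N)%:R - (N 2)%:R)%R; last by rewrite N1 N2 subr0.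
congr (_ + _)%R.
  rewrite (eq_bigl (mem [set s : {perm 'I_p} | #|porbits s| == 1%N])) => [|s]; last first.
    by rewrite !inE; case: #|porbits s| => [|[|[|m]]].
  rewrite (eq_bigr (fun=> 1%R)) ?sumr_const // => s; rewrite !inE => /eqP s1.
  by rewrite sgnE s1.
rewrite (eq_bigl (mem [set s : {perm 'I_p} | #|porbits s| == 2])) => [|s]; last first.
  rewrite !inE; have : #|porbits s| != 0%N.
    rewrite -lt0n; apply/card_gt0P; exists (porbit s (Ordinal (prime_gt0 p_prime))).
    exact: imset_f.
  by case: #|porbits s| => [|[|[|m]]].
rewrite (eq_bigr (fun=> (-1)%R)) => [|s]; last by rewrite !inE => /eqP s2; rewrite sgnE s2.
by rewrite sumr_const -mulNrn.
Qed.

End CyclicShift.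

(** * Bounds for families without zero-sum tuples *)

Lemma leq_M (Q n D1 D2 : nat) : (D1 <= D2)%N -> (M Q n D1 <= M Q n D2)%N.
Proof.
move=> D12; apply/subset_leq_card/subsetP => a; rewrite !inE => aD.
exact: leq_trans aD D12.
Qed.

Lemma card_partition_le (I : finType) (pi : {set {set I}}) :
  partition pi [set: I] -> (#|pi| <= #|I|)%N.
Proof.
move=> piP; rewrite -cardsT (card_partition piP) -sum1_card.
apply: leq_sum => b bpi; rewrite card_gt0; have /and3P[_ _] := piP.
by apply: contraNneq => <-.
Qed.

Lemma sum_card_partitions (p : nat) :
  (\sum_(pi | partition pi [set: 'I_p] && (2 < #|pi|)) #|pi| = B p)%N.
Proof.
rewrite /B (eq_bigr (fun r =>
  \sum_(pi | partition pi [set: 'I_p] && (#|pi| == r)) r)%N); last first.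
  by move=> r _; rewrite sum_nat_cond_const mulnC /stirling2.
rewrite big_nat /= (exchange_big_dep (fun pi =>
  partition pi [set: 'I_p] && (2 < #|pi|)%N)) /=; last first.
  by move=> r pi /andP[r3 _] /andP[-> /eqP ->].
apply: eq_bigr => pi /andP[piP pi3].
rewrite piP /= -big_filter (_ : [seq _ <- _ | _] = [:: #|pi|]) ?big_seq1 //.
rewrite (eq_in_filter (a2 := pred1 #|pi|)) => [|r].
  rewrite filter_pred1_uniq ?iota_uniq // mem_index_iota pi3 ltnS.
  by rewrite -[X in (_ <= X)%N]card_ord card_partition_le.
by rewrite mem_index_iota /= eq_sym => ->.
Qed.

Lemma card_values_le (I X : finType) (pi : {set {set I}}) (y : {ffun I -> X}) :
  partition pi [set: I] -> const_on_blocks pi y ->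
  (#|[set y i | i : I]| <= #|pi|)%N.
Proof.
move=> piP /forall_inP yP; have [/eqP cov triv nov] := and3P piP.
case: (pickP (fun _ : I => true)) => [i0 _|I0]; last first.
  rewrite (_ : [set y i | i : I] = set0) ?cards0 //; apply/setP => x.
  by rewrite inE; apply/imsetP => -[i]; have := I0 i.
apply: leq_trans (leq_imset_card (fun b : {set I} => y (odflt i0 [pick i in b])) (mem pi)).
apply/subset_leq_card/subsetP => _ /imsetP[i _ ->].
have ic : i \in cover pi by rewrite cov inE.
apply/imsetP; exists (pblock pi i); first by rewrite /= pblock_mem.
case: pickP => [k kb|/(_ i)] /=; last by rewrite mem_pblock ic.
have /forall_inP/(_ i) := yP _ (pblock_mem ic).
by rewrite mem_pblock ic => /(_ isT)/forall_inP/(_ k kb)/eqP.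
Qed.

Section ZeroSum.
Variables (F : finFieldType) (p n : nat) (X : finType) (u : X -> 'I_n -> F).
Hypothesis p_prime : prime p.
Hypothesis p_odd : odd p.
Hypothesis p_char : p \in [pchar F].
Hypothesis u_neq0 : forall x j, u x j != 0.
Hypothesis u_inj : forall x y, u x =1 u y -> x = y.

Let Q := #|F|.-1.
Let i0 : 'I_p := Ordinal (prime_gt0 p_prime).

Lemma card_pred_gt0 : (0 < Q)%N.
Proof. by rewrite /Q -subn1 subn_gt0 finNzRing_gt1. Qed.

Lemma expf_card_pred (a : F) : a ^+ Q = (a != 0)%:R.
Proof.
have [->|a0] := eqVneq a 0; first by rewrite expr0n eqn0Ngt card_pred_gt0.
apply: (mulfI a0); rewrite -exprS mulr1 /Q prednK ?expf_card //.
by apply: ltn_trans (finNzRing_gt1 F).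
Qed.

Lemma zero_sum_tensorE (y : {ffun 'I_p -> X}) :
  zero_sum_tensor Q u y = [forall j, \sum_i u (y i) j == 0]%:R.
Proof.
case: (boolP [forall j, _]) => [/forallP y0|].
  by apply: big1 => j _; rewrite (eqP (y0 j)) expf_card_pred eqxx subr0.
rewrite negb_forall => /existsP[j yj].
by rewrite /zero_sum_tensor (bigD1 j) //= expf_card_pred yj subrr mul0r.
Qed.

Lemma sum_constant (y : {ffun 'I_p -> X}) j :
  (forall i, y i = y i0) -> \sum_i u (y i) j = 0.
Proof.
move=> yc; rewrite (eq_bigr (fun=> u (y i0) j)) => [|i _]; last by rewrite yc.
by rewrite sumr_const card_ord -mulr_natr (GRing.pcharf0 p_char) mulr0.
Qed.

Theorem strongly_zero_sum_free_bound :
  (forall y : {ffun 'I_p -> X}, (forall j, \sum_i u (y i) j = 0) ->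
     forall i k, y i = y k) ->
  (#|X| <= p * M Q n (Q * n %/ p))%N.
Proof.
move=> free.
pose pi1 : {set {set 'I_p}} := porbits 1%g.
have pi1p : #|pi1| = p by exact: card_porbits_id.
suff : (#|X| <= \sum_(pi in [set pi1]) #|pi| * M Q n (Q * n %/ #|pi|))%N.
  by rewrite big_set1 pi1p.
apply: (@diagonal_expansion_bound F _ X i0 n Q u [set pi1] (fun=> 1) 1).
- exact: card_pred_gt0.
- by move=> x j; rewrite expf_card_pred u_neq0.
- exact: oner_neq0.
- move=> pi /set1P ->; rewrite pi1p prime_gt1 //; split => //; exact: partition_porbits.
- move=> y; rewrite big_set1 !mulr1 mul1r zero_sum_tensorE.
  have -> : const_on_blocks pi1 y by rewrite const_on_porbits; apply/forallP => i; rewrite perm1.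
  rewrite mul1r; congr (_ %:R); congr nat_of_bool.
  apply/forallP/forallP => [yc j|y0 i].
    by apply/eqP/sum_constant => i; apply/eqP.
  by apply/eqP/free => j; apply/eqP.
Qed.

(** If [y] takes the value [y i0] exactly [m] times and a second value at the
[p - m] other positions, then the sum is [m] times the difference of the two
values in characteristic [p], and [0 < m < p]. *)
Lemma two_valued_zero_sum (pi : {set {set 'I_p}}) (y : {ffun 'I_p -> X}) :
  partition pi [set: 'I_p] -> (#|pi| <= 2)%N -> const_on_blocks pi y ->
  (forall j, \sum_i u (y i) j = 0) -> forall i, y i = y i0.
Proof.
move=> piP pi2 yP y0 k; apply: contrapT => /eqP yk.
have vals i : y i != y i0 -> y i = y k.
  move=> yi; apply/eqP; apply: contraT => yik.
  have := leq_trans (card_values_le piP yP) pi2.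
  rewrite leqNgt => /negP[]; apply: leq_trans (_ : #|[set y i0; y k; y i]| <= _)%N.
    by rewrite setUC cardsU1 cards2 !inE negb_or yi yik eq_sym yk.
  apply/subset_leq_card/subsetP => x; rewrite !inE => /orP[/orP[]|] /eqP ->; exact: imset_f.
pose m := #|[set i | y i == y i0]|.
have m0 : (0 < m)%N by apply/card_gt0P; exists i0; rewrite inE.
have mp : (m < p)%N.
  rewrite -[X in (_ < X)%N]card_ord -cardsT; apply: proper_card.
  by rewrite properT; apply/eqP => /setP/(_ k); rewrite !inE (negPf yk).
case/eqP: yk; apply: u_inj => j.
have := y0 j; rewrite (bigID (fun i => y i == y i0)) /=.
rewrite (eq_bigr (fun=> u (y i0) j)) => [|i /eqP -> //].
rewrite [X in _ + X](eq_bigr (fun=> u (y k) j)) => [|i /vals -> //].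
rewrite !sumr_const -cardsE -/m.
have -> : #|[pred i | y i != y i0]| = (p - m)%N.
  apply/(@addnI m); rewrite subnKC ?(ltnW mp) //.
  have := cardsC [set i | y i == y i0]; rewrite card_ord -/m => mC.
  apply: etrans mC; congr addn.
  by apply: eq_card => i; rewrite !inE.
rewrite mulrnBr ?(ltnW mp) // -[u (y k) j *+ p]mulr_natr (GRing.pcharf0 p_char) mulr0 sub0r.
rewrite -mulrnBl => /eqP; rewrite -mulr_natr mulf_eq0 subr_eq0 => /orP[/eqP -> //|].
by rewrite -(GRing.dvdn_pcharf p_char) gtnNdvd.
Qed.

Theorem distinctly_zero_sum_free_bound :
  (forall y : {ffun 'I_p -> X}, injective y ->
     ~ (forall j, \sum_i u (y i) j = 0)) ->
  (#|X| <= B p * M Q n (Q * n %/ 3))%N.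
Proof.
move=> free.
pose Pi := [set pi : {set {set 'I_p}} | partition pi [set: 'I_p] && (2 < #|pi|)%N].
apply: (@leq_trans (\sum_(pi in Pi) #|pi| * M Q n (Q * n %/ #|pi|))%N); last first.
  rewrite -sum_card_partitions big_distrl /=.
  rewrite [X in (_ <= X)%N](eq_bigl (mem Pi)) => [|pi]; last by rewrite !inE.
  apply: leq_sum => pi; rewrite inE => /andP[_ pi3].
  by rewrite leq_mul2l leq_M ?orbT // leq_div2l.
pose mu pi : F := \sum_(s : {perm 'I_p} | porbits s == pi) (-1) ^+ s.
apply: (@diagonal_expansion_bound F _ X i0 n Q u Pi mu 1).
- exact: card_pred_gt0.
- by move=> x j; rewrite expf_card_pred u_neq0.
- exact: oner_neq0.
- by move=> pi; rewrite inE => /andP[? ?]; split => //; apply: ltnW.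
move=> y; rewrite mulr1; set T := zero_sum_tensor Q u y.
(* The signed sum over all permutations vanishes; its part with at most two
   cycles is minus the diagonal tensor. *)
have inj0 : (injectiveb y)%:R * T = 0.
  case: (injectiveP y) => [yinj|_]; last by rewrite mul0r.
  rewrite mul1r /T zero_sum_tensorE (_ : [forall j, _] = false) //.
  by apply/negP => /forallP y0; apply: (free y yinj) => j; apply/eqP.
pose w (s : {perm 'I_p}) := (-1) ^+ s * ((const_on_blocks (porbits s) y)%:R * T).
have w0 : \sum_s w s = 0.
  rewrite -[RHS]inj0 -sum_sign_fixing mulr_suml; apply: eq_bigr => s _.
  by rewrite /w const_on_porbits mulrA.
rewrite (bigID (fun s => #|porbits s| <= 2)%N) /= in w0.
rewrite (eq_bigr (fun s : {perm 'I_p} =>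
  (-1) ^+ s * [forall i, y i == y i0]%:R)) in w0; last first.
  move=> s s2; congr (_ * _); rewrite /T zero_sum_tensorE -natrM mulnb; congr (_%:R).
  congr nat_of_bool; apply/andP/forallP => [[yP /forallP y0] i|yc].
    apply/eqP; apply: (two_valued_zero_sum (partition_porbits s) s2 yP) => j.
    by apply/eqP.
  split; last by apply/forallP => j; apply/eqP/sum_constant => i; apply/eqP.
  by rewrite const_on_porbits; apply/forallP => i; rewrite (eqP (yc i)) (eqP (yc _)).
rewrite -mulr_suml sum_sign_porbits_le2 // mulN1r in w0.
move/eqP: w0; rewrite addrC subr_eq0 => /eqP <-.
rewrite (partition_big (@porbits _) (mem Pi)) /=; last first.
  by move=> s; rewrite inE partition_porbits -ltnNge.
apply: eq_bigr => pi; rewrite inE => /andP[_ pi3]; rewrite /mu mulr_suml.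
apply: eq_big => [s|s /andP[_ /eqP <-] //].
by case: eqP => [->|]; rewrite ?andbF // -ltnNge pi3.
Qed.

End ZeroSum.

(** * Exponential growth of the number of exponent vectors *)

(** The common form of [eta_qp] and [theta_q], which are the cases [a = Q / p]
and [a = Q / 3] for [Q = q - 1]. *)
Definition growth_rate (R : realType) (Q : nat) (a : R) : R :=
  inf [set y : R | exists2 rho : R, 0 < rho < 1 &
    y = (\sum_(i < Q) rho ^+ i) * rho `^ (- a)]%classic.

Section GrowthRate.
Variables (R : realType) (Q : nat).

(** A vector counted on the left has weight [rho ^ (sum_i b i) >= rho ^ (a * n)],
and the weights of all vectors sum to [(sum_i rho ^ i) ^ n]. *)
Lemma M_le_weighted (n D : nat) (a rho : R) :
  0 < rho < 1 -> D%:R <= a * n%:R ->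
  (M Q n D)%:R <= ((\sum_(i < Q) rho ^+ i) * rho `^ (- a)) ^+ n.
Proof.
move=> /andP[rho0 rho1] Da.
rewrite exprMn -[X in _ * X]powR_mulrn ?powR_ge0 // -powRrM mulNr.
rewrite -{2}[n]card_ord -prodr_const bigA_distr_bigA /= mulr_suml.
rewrite /M -sum1_card natr_sum big_mkcond /=; apply: ler_sum => b _.
rewrite prodrXr; case: ifP => [|_]; last first.
  by rewrite mulr_ge0 ?powR_ge0 ?exprn_ge0 ?(ltW rho0).
rewrite inE => bD; rewrite -powR_mulrn ?(ltW rho0) // -powRD; last first.
  by rewrite (gt_eqF rho0) implybT.
rewrite -[X in X <= _](powRr0 rho); apply: ger_powR; first by rewrite rho0 ltW.
by rewrite subr_le0; apply: le_trans Da; rewrite ler_nat.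
Qed.

Lemma growth_rate_lbound (a : R) : has_lbound
  [set y : R | exists2 rho : R, 0 < rho < 1 &
    y = (\sum_(i < Q) rho ^+ i) * rho `^ (- a)]%classic.
Proof.
exists 0 => y [rho /andP[rho0 _] ->]; rewrite mulr_ge0 ?powR_ge0 // sumr_ge0 // => i _.
by rewrite exprn_ge0 // ltW.
Qed.

Lemma growth_rate_glb (a r : R) :
  (forall rho : R, 0 < rho < 1 ->
    r <= (\sum_(i < Q) rho ^+ i) * rho `^ (- a)) ->
  r <= growth_rate Q a.
Proof.
move=> rP; apply: lb_le_inf => [|y [rho rho01 ->]]; last exact: rP.
exists ((\sum_(i < Q) 2^-1 ^+ i) * 2^-1 `^ (- a)), 2^-1 => //.
by rewrite invr_gt0 ltr0n invf_lt1 ?ltr0n // ltr1n.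
Qed.

Lemma growth_rate_ge0 (a : R) : 0 <= growth_rate Q a.
Proof.
apply: growth_rate_glb => rho /andP[rho0 _]; rewrite mulr_ge0 ?powR_ge0 // sumr_ge0 // => i _.
by rewrite exprn_ge0 // ltW.
Qed.

Lemma M_le_growth_rate (n D : nat) (a : R) : (0 < n)%N ->
  D%:R <= a * n%:R -> (M Q n D)%:R <= growth_rate Q a ^+ n.
Proof.
move=> n0 Da; pose r : R := (M Q n D)%:R `^ (n%:R^-1).
have rn : r ^+ n = (M Q n D)%:R.
  by rewrite -powR_mulrn ?powR_ge0 // -powRrM mulVf ?powRr1 // pnatr_eq0 -lt0n.
rewrite -rn; apply: lerXn2r; rewrite ?nnegrE ?powR_ge0 ?growth_rate_ge0 //.
apply: growth_rate_glb => rho rho01.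
rewrite -(ler_pXn2r n0) ?nnegrE ?powR_ge0 // ?rn ?M_le_weighted //.
case/andP: rho01 => rho0 _; rewrite mulr_ge0 ?powR_ge0 // sumr_ge0 // => i _.
by rewrite exprn_ge0 // ltW.
Qed.

Lemma onem_expr_le (e : R) (m : nat) : 0 <= e <= 1 ->
  (1 - e) ^+ m <= 1 - m%:R * e + m%:R ^+ 2 * e ^+ 2.
Proof.
move=> /andP[e0 e1]; elim: m => [|m IH]; first by rewrite expr0; nra.
have m0 : 0 <= m%:R :> R by [].
have := ler_wpM2l (_ : 0 <= 1 - e) IH; rewrite -exprS subr_ge0 => /(_ e1) /le_trans; apply.
have : 0 <= m%:R ^+ 2 * e ^+ 3 by rewrite mulr_ge0 ?exprn_ge0.
have : 0 <= m%:R * e ^+ 2 by rewrite mulr_ge0 ?exprn_ge0.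
by rewrite -natr1; nra.
Qed.

Lemma onem_expr_ge (e : R) (m : nat) : 0 <= e <= 1 ->
  1 - m%:R * e <= (1 - e) ^+ m.
Proof.
move=> /andP[e0 e1]; elim: m => [|m IH]; first by rewrite expr0; lra.
have m0 : 0 <= m%:R :> R by [].
have := ler_wpM2l (_ : 0 <= 1 - e) IH; rewrite -exprS subr_ge0 => /(_ e1); apply: le_trans.
have : 0 <= m%:R * e ^+ 2 by rewrite mulr_ge0 ?exprn_ge0.
by rewrite -natr1; nra.
Qed.

(** Put [rho = t ^ 3] and [t = 1 - e], which removes the fractional exponent: it
suffices that [sum_(i < Q) t ^ (3 i) < Q * t ^ Q].  To first order in [e] this
compares [Q - 3 e Q (Q - 1) / 2] with [Q - Q ^ 2 e].  The difference
[Q (Q - 3) e / 2] exceeds the second-order error [9 Q ^ 3 e ^ 2] for the value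
of [e] chosen below. *)
Lemma growth_rate_lt (a : R) : (3 < Q)%N -> a <= Q%:R / 3 ->
  growth_rate Q a < Q%:R.
Proof.
move=> Q3 aQ; set x : R := Q%:R.
have x4 : 4 <= x by rewrite ler_nat.
pose e : R := (20 * x ^+ 2)^-1.
have ex : 20 * x ^+ 2 * e = 1 by rewrite mulfV //; apply: lt0r_neq0; nra.
have e0 : 0 < e by rewrite invr_gt0; nra.
have e1 : e < 1 by rewrite invf_lt1; nra.
have e01 : 0 <= e <= 1 by rewrite !ltW.
pose t := 1 - e.
have t0 : 0 < t by rewrite /t; lra.
have t1 : t < 1 by rewrite /t; lra.
have rho01 : 0 < t ^+ 3 < 1 by rewrite exprn_gt0 //= exprn_ilt1 // ltW.
apply: (@le_lt_trans _ _ ((\sum_(i < Q) (t ^+ 3) ^+ i) * (t ^+ 3) `^ (- a))).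
  by apply: ge_inf; [exact: growth_rate_lbound|exists (t ^+ 3)].
have S0 : 0 <= \sum_(i < Q) (t ^+ 3) ^+ i.
  by apply: sumr_ge0 => i _; rewrite !exprn_ge0 // ltW.
apply: (@le_lt_trans _ _ ((\sum_(i < Q) (t ^+ 3) ^+ i) * (t ^+ Q)^-1)).
  apply: ler_wpM2l => //.
  have -> : (t ^+ Q)^-1 = (t ^+ 3) `^ (- (Q%:R / 3)).
    rewrite -!powR_mulrn ?(ltW t0) // -powRrM -powRN; congr (_ `^ _).
    by field.
  apply: ger_powR; last by rewrite lerN2.
  by case/andP: rho01 => -> /ltW ->.
rewrite ltr_pdivrMr ?exprn_gt0 //.
have sumb (K : nat) : (K <= Q)%N ->
  2 * \sum_(i < K) (t ^+ 3) ^+ i <=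
  2 * K%:R - 3 * e * (K%:R * (K%:R - 1)) + 18 * K%:R * x ^+ 2 * e ^+ 2.
  elim: K => [|K IH] KQ; first by rewrite big_ord0; lra.
  rewrite big_ord_recr /= mulrDr.
  have := IH (ltnW KQ); have := onem_expr_le (3 * K) e01.
  rewrite exprM -/t natrM -natr1.
  have K0 : 0 <= K%:R :> R by [].
  have Kx : K%:R <= x by rewrite ler_nat ltnW.
  have : K%:R ^+ 2 * e ^+ 2 <= x ^+ 2 * e ^+ 2.
    by rewrite ler_wpM2r ?exprn_ge0 ?(ltW e0) // lerXn2r ?nnegrE //; lra.
  by lra.
have := sumb Q (leqnn _); rewrite -/x.
have := ler_wpM2l (_ : 0 <= x) (onem_expr_ge Q e01); rewrite -/x -/t => /(_ ltac:(lra)).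
set S := \sum_(i < Q) _ => L U.
have : 18 * x * x ^+ 2 * e ^+ 2 = 9 / 10 * x * e.
  by transitivity (9 / 10 * x * e * (20 * x ^+ 2 * e)); [field | rewrite ex mulr1].
have : 0 < x * e by nra.
have : 4 * (x * e) <= x * (x * e) by nra.
by nra.
Qed.

End GrowthRate.

(** * Vanishing of the elementary symmetric polynomial on the torus *)

Lemma esym_pred_inverses (F : fieldType) (m : nat) (x : 'I_m -> F) :
  (0 < m)%N -> (forall i, x i != 0) ->
  Defs.esym m.-1 x = (\prod_i x i) * \sum_i (x i)^-1.
Proof.
move=> m0 x0; rewrite /Defs.esym mulr_sumr.
transitivity (\sum_(I in [set [set~ i] | i : 'I_m]) \prod_(i in I) x i).
  apply: eq_bigl => I; apply/eqP/imsetP => [Im|[i _ ->]]; last by rewrite cardsC1 card_ord.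
  have /eqP/cards1P[i Ii] : #|~: I| = 1%N.
    by rewrite cardsCs setCK card_ord Im; case: (m) m0 => // k _; rewrite subSnn.
  by exists i; rewrite // -Ii setCK.
rewrite big_imset /=; last by move=> i k _ _ /(congr1 (@setC _)); rewrite !setCK => /set1_inj.
apply: eq_bigr => i _; rewrite [in RHS](bigD1 i) //= mulrAC mulfV ?x0 // mul1r.
by apply: eq_bigl => k; rewrite !inE.
Qed.

Lemma esym_vanishesP (F : finFieldType) (n p : nat) (x : 'I_p -> 'rV[F]_n) :
  (0 < p)%N -> (forall i, x i \in torus F n) ->
  esym_vanishes x <-> forall j, \sum_i (x i 0 j)^-1 = 0.
Proof.
move=> p0 xT.
have x0 i j : x i 0 j != 0 by move: (xT i); rewrite inE => /forallP.
have E j : Defs.esym p.-1 (fun i => x i 0 j) = (\prod_i x i 0 j) * \sum_i (x i 0 j)^-1.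
  by apply: esym_pred_inverses.
split=> H j; last by rewrite E H mulr0.
have /eqP := H j; rewrite E mulf_eq0 prodf_seq_eq0 => /orP[/hasP[i _]|/eqP //].
by rewrite (negPf (x0 i j)).
Qed.

Lemma natr_div_le (R : realType) (m d : nat) : (0 < d)%N ->
  (m %/ d)%:R <= m%:R / d%:R :> R.
Proof. by move=> d0; rewrite ler_pdivlMr ?ltr0n // -natrM ler_nat leq_divM. Qed.

(** * The bounds for free sets and sequences *)

Section Torus.
Variables (F : finFieldType) (p k n : nat) (A : {set 'rV[F]_n}).
Hypothesis p_prime : prime p.
Hypothesis p_odd : odd p.
Hypothesis card_F : #|F| = (p ^ k)%N.
Hypothesis A_torus : A \subset torus F n.

Let X : finType := {v : 'rV[F]_n | v \in A}.
Let u (v : X) (j : 'I_n) : F := (val v 0 j)^-1.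
Let Q := #|F|.-1.

Let p_char : p \in [pchar F]. Proof. exact: card_finPcharP card_F p_prime. Qed.

Let u_neq0 v j : u v j != 0.
Proof.
have := subsetP A_torus _ (valP v).
by rewrite inE => /forallP/(_ j); rewrite invr_eq0.
Qed.

Let u_inj v w : u v =1 u w -> v = w.
Proof.
move=> uvw; apply/val_inj/rowP => j; apply: invr_inj; exact: uvw.
Qed.

Let zero_sumP (y : {ffun 'I_p -> X}) : 
  (forall j, \sum_i u (y i) j = 0) <-> esym_vanishes (fun i => val (y i)).
Proof.
apply: iff_sym; apply: esym_vanishesP => [|i]; first exact: prime_gt0.
exact: (subsetP A_torus) (valP (y i)).
Qed.

Lemma strongly_free_bound :
  strongly_free p A -> (#|A| <= p * M Q n (Q * n %/ p))%N.
Proof.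
move=> free; have -> : #|A| = #|X| by rewrite card_sig; apply: eq_card.
apply: (strongly_zero_sum_free_bound p_prime p_char u_neq0).
move=> y /zero_sumP y0 i l; apply/val_inj.
exact: (free (fun i => val (y i)) (fun i => valP (y i)) y0).
Qed.

Lemma distinctly_free_bound :
  distinctly_free p A -> (#|A| <= B p * M Q n (Q * n %/ 3))%N.
Proof.
move=> free; have -> : #|A| = #|X| by rewrite card_sig; apply: eq_card.
apply: (distinctly_zero_sum_free_bound p_prime p_odd p_char u_neq0 u_inj).
move=> y yinj /zero_sumP.
apply: (free (fun i => val (y i)) (fun i => valP (y i))).
by move=> i l /val_inj/yinj.
Qed.

End Torus.

(** Too many copies of one value, or [p] distinct values, would form a
subsequence of length [p] whose inverses sum to zero.  The distinct values need
not appear in [S] in the order in which [distinctly_free] lists them, but the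
sum does not depend on the order. *)
Lemma seq_free_multiplicity (F : finFieldType) (p k n : nat) (S : seq 'rV[F]_n) :
  prime p -> #|F| = (p ^ k)%N ->
  {subset S <= torus F n} -> seq_free p S ->
  (size S <= p.-1 * #|[set v in S]|)%N /\ distinctly_free p [set v in S].
Proof.
move=> p_prime card_F ST free.
have pF := card_finPcharP card_F p_prime.
have p0 := prime_gt0 p_prime.
have nonvanishing (t : p.-tuple 'rV[F]_n) : subseq t S ->
    ~ (forall j, \sum_(v <- t) (v 0 j)^-1 = 0).
  move=> tS t0; apply: (free t tS); apply/esym_vanishesP => // [i|j].
    by apply: ST; apply: (mem_subseq tS); apply: mem_tnth.
  by have := t0 j; rewrite big_tuple.
split.
  rewrite -sum1_size big_seq (partition_big id (mem [set v in S])) /=; last by move=> v; rewrite inE.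
  rewrite mulnC -sum_nat_const; apply: leq_sum => v _.
  apply: (@leq_trans (count_mem v S)).
    rewrite -sum1_count [X in (_ <= X)%N]big_mkcond [X in (X <= _)%N]big_mkcond /=.
    by apply: leq_sum => w _; case: (w \in S).
  rewrite -ltnS prednK // ltnNge; apply/negP => pS.
  have t_size : size (take p (filter (pred1 v) S)) == p by rewrite size_takel ?size_filter.
  apply: (nonvanishing (Tuple t_size)) => [|j].
    exact: subseq_trans (take_subseq _ _) (filter_subseq _ _).
  rewrite (eq_big_seq (fun=> (v 0 j)^-1)) => [|w]; last first.
    by move=> /mem_take; rewrite mem_filter => /andP[/eqP ->].
  rewrite big_const_seq count_predT (eqP t_size) iter_addr_0.
  by rewrite -mulr_natr (GRing.pcharf0 pF) mulr0.
move=> x xS xinj.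
have xT i : x i \in torus F n by apply: ST; have := xS i; rewrite inE.
move=> /(esym_vanishesP p0 xT) x0.
pose t := filter (mem (codom x)) (undup S).
have t_perm : perm_eq t (codom x).
  apply: uniq_perm; rewrite ?filter_uniq ?undup_uniq //.
    by rewrite /codom /image_mem map_inj_uniq ?enum_uniq.
  move=> v; rewrite mem_filter mem_undup; apply/andb_idr => /codomP[i ->].
  by have := xS i; rewrite inE.
have t_size : size t == p by rewrite (perm_size t_perm) size_codom card_ord.
apply: (nonvanishing (Tuple t_size)).
  exact: subseq_trans (filter_subseq _ _) (undup_subseq _).
by move=> l; rewrite (perm_big _ t_perm) /= /codom big_image.
Qed.

Theorem corollary6p1 (R : realType) (F : finFieldType) (p k q n : nat)
    (p_prime : prime p) (p_odd : odd p) (q_def : q = (p ^ k)%N)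
    (q_gt4 : (4 < q)%N) (card_F : #|F| = q) (n_ge1 : (1 <= n)%N) :
  (forall A : {set 'rV[F]_n}, A \subset torus F n -> strongly_free p A ->
     [/\ (#|A| <= p * M q.-1 n ((q.-1 * n) %/ p))%N,
         (p * M q.-1 n ((q.-1 * n) %/ p))%N%:R <= p%:R * eta_qp R q p ^+ n
       & eta_qp R q p < q%:R - 1])
  /\ (forall A : {set 'rV[F]_n}, A \subset torus F n -> distinctly_free p A ->
     #|A|%:R <= (B p)%:R * theta_q R q ^+ n /\ theta_q R q < q%:R - 1)
  /\ (forall S : seq 'rV[F]_n, {subset S <= torus F n} -> seq_free p S ->
     (size S)%:R <= (p.-1 * B p)%N%:R * theta_q R q ^+ n).
Proof.
have FE : #|F| = (p ^ k)%N by rewrite card_F.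
have p_gt2 := odd_prime_gt2 p_odd p_prime.
have Q_gt0 : (0 < q.-1)%N by case: (q) q_gt4 => [|[]].
have Q_gt3 : (3 < q.-1)%N by rewrite -ltnS prednK // (ltn_trans _ q_gt4).
have QE : q.-1%:R = q%:R - 1 :> R by rewrite -subn1 natrB // (ltn_trans _ q_gt4).
have weight d : (0 < d)%N ->
    (M q.-1 n (q.-1 * n %/ d))%:R <= growth_rate q.-1 (q.-1%:R / d%:R : R) ^+ n.
  move=> d0; apply: M_le_growth_rate => //.
  by apply: le_trans (natr_div_le _ _ d0) _; rewrite natrM mulrAC.
have rate_lt d : (2 < d)%N -> growth_rate q.-1 (q.-1%:R / d%:R : R) < q%:R - 1.
  move=> d3; rewrite -QE; apply: growth_rate_lt => //.
  apply: ler_wpM2l => //; rewrite lef_pV2 ?posrE ?ltr0n ?(ltn_trans _ d3) //.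
  by rewrite ler_nat.
have distinct_bound (A : {set 'rV[F]_n}) : A \subset torus F n -> distinctly_free p A ->
    #|A|%:R <= (B p)%:R * theta_q R q ^+ n.
  move=> AT /(distinctly_free_bound p_prime p_odd FE AT); rewrite card_F => AB.
  apply: (@le_trans _ _ (B p * M q.-1 n (q.-1 * n %/ 3))%N%:R); first by rewrite ler_nat.
  by rewrite natrM ler_wpM2l //; apply: weight.
split; [|split] => [A AT free|A AT free|S ST free].
- split; first by have := strongly_free_bound p_prime FE AT free; rewrite card_F.
    by rewrite natrM ler_wpM2l //; apply: weight; apply: prime_gt0.
  exact: rate_lt.
- by split; [exact: distinct_bound|exact: (rate_lt 3)].
- have [size_le free'] := seq_free_multiplicity p_prime FE ST free.
  apply: (@le_trans _ _ (p.-1 * #|[set v in S]|)%N%:R); first by rewrite ler_nat.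
  rewrite !natrM -mulrA ler_wpM2l //; apply: distinct_bound free'.
  by apply/subsetP => v; rewrite inE => /ST.
Qed.
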